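(* Let $L>0$, $\lambda>6$, $a>0$, and let $v$ be a solution of the problem $$v_t+D^4v+D^2v=\tfrac12D(v^2),\qquad v(x,0)=v_0(x),\qquad B_0(v)=h(t)\ \text{ at } x=0 \text{ for } t>0,$$ such that $H_\lambda(v,L):=B_0(v)-C_\lambda(L)\ge a^2>0$ for all $t>0$ for which the solution exists. Then $v$ cannot be global in time: there is no global solution of this problem. Moreover, there is no global solution of this problem for $x\in(0,L)$, and, as long as the solution exists, $$J(t):=\int_0^L v(x,t)|x-L|^\lambda\,dx\ \ge\ \frac a\kappa\tan(a\kappa t+c_0),$$ where $$\kappa=\Big(\frac{\lambda(\lambda+2)}4L^{-(2+\lambda)}\Big)^{1/2},\qquad c_0=\arctan\frac{\kappa J_0}{a},\qquad J_0=\int_0^L v_0(x)|x-L|^\lambda\,dx,$$ and the blow-up time $T_\infty$ satisfies $$T_\infty\le\frac{\frac\pi2-c_0}{a\kappa}.$$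
   Context: Here $D=\partial/\partial x$, $\Omega=(0,L)$, and for $\lambda>6$, $L>0$: $$B_0(v)=-\tfrac12L^\lambda v^2(0,t)+\lambda L^{\lambda-1}\big[1+(\lambda-1)(\lambda-2)L^{-2}\big]v(0,t)+L^\lambda\big[1+\lambda(\lambda-1)L^{-2}\big]Dv(0,t)+\lambda L^{\lambda-1}D^2v(0,t)+L^\lambda D^3v(0,t),$$ $$C_\lambda(L)=\lambda(\lambda-1)^2L^{\lambda-6}\Big[\frac{(\lambda-2)^2(\lambda-3)^2}{\lambda-6}+\frac{2(\lambda-2)(\lambda-3)}{\lambda-4}L^2+\frac1{\lambda-2}L^4\Big].$$ A solution is understood in the weak sense: $v$ belongs to a function class in which the following makes sense, and for every $\psi\in C^4(\mathbb R)$, $$\frac{d}{dt}\int_\Omega v\psi\,dx+\int_\Omega v(D^4\psi+D^2\psi)\,dx=-\frac12\int_\Omega v^2D\psi\,dx+B(v,\psi),$$ $$B(v,\psi)=\Big[vD^3\psi-Dv\,D^2\psi+(D^2v+v)D\psi-(D^3v+Dv)\psi+\tfrac12v^2\psi\Big]_{x=0}^{x=L},$$ with initial data attained in the sense $\int_\Omega v(x,t)\psi(x)\,dx\to\int_\Omega v_0\psi\,dx$ as $t\to0$. The blow-up time $T_\infty$ is the supremum of times up to which the solution exists. *)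

(* Defs.v *)
From mathcomp Require Import all_boot all_order all_algebra.
From mathcomp Require Import all_classical all_reals all_analysis.

Set Implicit Arguments.
Unset Strict Implicit.
Unset Printing Implicit Defensive.

Import Order.TTheory GRing.Theory Num.Theory.
Import numFieldNormedType.Exports.

Local Open Scope ring_scope.
Local Open Scope classical_set_scope.

Section KuramotoSivashinsky.
Context {R : realType}.

Definition C4 (psi : R -> R) : Prop :=
  (forall k x, (k < 4)%N -> derivable (derive1n k psi) x 1) /\
  continuous (derive1n 4 psi).

(* Boundary values of D^k u, k <= 3, are one-sided limits: F is 0^'+ (the end
   point 0) or L^'- (the end point L).  No derivative is required to exist away
   from the two end points, as suits a weak solution. *)
Definition has_traces (u : R -> R) (F : set_system R) : Prop :=
  (\forall x \near F, forall k, (k < 3)%N -> derivable (derive1n k u) x 1) /\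
  (forall k, (k <= 3)%N -> cvg (derive1n k u x @[x --> F])).

Definition trace (F : set_system R) (k : nat) (u : R -> R) : R :=
  lim (derive1n k u x @[x --> F]).

(* The bracket in B(v, psi) at the end point p; D^k v(., t) is evaluated there
   through F. *)
Definition boundary_flux (F : set_system R) (p : R) (u psi : R -> R) : R :=
  trace F 0 u * derive1n 3 psi p - trace F 1 u * derive1n 2 psi p
  + (trace F 2 u + trace F 0 u) * derive1n 1 psi p
  - (trace F 3 u + trace F 1 u) * psi p
  + 2^-1 * trace F 0 u ^+ 2 * psi p.

Definition boundary_form (L : R) (u psi : R -> R) : R :=
  boundary_flux L^'- L u psi - boundary_flux 0^'+ 0 u psi.

Definition B0 (L lambda : R) (v : R -> R -> R) (t : R) : R :=
  let D k := trace 0^'+ k (v^~ t) in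
  - 2^-1 * L `^ lambda * D 0%N ^+ 2
  + lambda * L `^ (lambda - 1)
    * (1 + (lambda - 1) * (lambda - 2) * L ^- 2) * D 0%N
  + L `^ lambda * (1 + lambda * (lambda - 1) * L ^- 2) * D 1%N
  + lambda * L `^ (lambda - 1) * D 2%N
  + L `^ lambda * D 3%N.

Definition C_lambda (L lambda : R) : R :=
  lambda * (lambda - 1) ^+ 2 * L `^ (lambda - 6)
  * ((lambda - 2) ^+ 2 * (lambda - 3) ^+ 2 / (lambda - 6)
     + 2 * (lambda - 2) * (lambda - 3) / (lambda - 4) * L ^+ 2
     + (lambda - 2)^-1 * L ^+ 4).

Definition H_lambda (L lambda : R) (v : R -> R -> R) (t : R) : R :=
  B0 L lambda v t - C_lambda L lambda.

(* The regularity under which every term of the weak formulation is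
   meaningful at a given time: u is in L^2(0, L) and has boundary values up to
   order 3. *)
Definition admissible (L : R) (u : R -> R) : Prop :=
  [/\ measurable_fun `]0, L[ u,
      lebesgue_measure.-integrable `]0, L[ (fun x => (u x ^+ 2)%:E),
      has_traces u 0^'+ & has_traces u L^'-].

Definition weak_equation (L : R) (v : R -> R -> R) (psi : R -> R) (t : R) :
  Prop :=
  is_derive t 1 (fun s => \int[lebesgue_measure]_(x in `]0, L[) (v x s * psi x))
    (- (\int[lebesgue_measure]_(x in `]0, L[)
          (v x t * (derive1n 4 psi x + derive1n 2 psi x)))
     - 2^-1 * (\int[lebesgue_measure]_(x in `]0, L[)
          (v x t ^+ 2 * derive1n 1 psi x))
     + boundary_form L (v^~ t) psi).

(* v solves the problem with data v0, h for 0 < t < T; T = +oo means that v is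
   global in time. *)
Definition weak_solution (L lambda : R) (v0 h : R -> R) (v : R -> R -> R)
  (T : \bar R) : Prop :=
  [/\ lebesgue_measure.-integrable `]0, L[ (EFin \o v0),
      forall t, 0 < t -> (t%:E < T)%E -> admissible L (v^~ t),
      forall t, 0 < t -> (t%:E < T)%E ->
        forall psi, C4 psi -> weak_equation L v psi t,
      forall psi, C4 psi ->
        \int[lebesgue_measure]_(x in `]0, L[) (v x t * psi x) @[t --> 0^'+]
        --> \int[lebesgue_measure]_(x in `]0, L[) (v0 x * psi x)
    & forall t, 0 < t -> (t%:E < T)%E -> B0 L lambda v t = h t].

Definition blowup_time (L lambda : R) (v0 h : R -> R)
  (v : R -> R -> R) : \bar R :=
  ereal_sup [set T | (0 < T)%E /\ weak_solution L lambda v0 h v T].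

Definition J (L lambda : R) (u : R -> R) : R :=
  \int[lebesgue_measure]_(x in `]0, L[) (u x * `|x - L| `^ lambda).

Definition kappa (L lambda : R) : R :=
  Num.sqrt (lambda * (lambda + 2) / 4 * L `^ (- (2 + lambda))).

Definition c0 (L lambda a : R) (v0 : R -> R) : R :=
  atan (kappa L lambda * J L lambda v0 / a).

End KuramotoSivashinsky.

(* Main.v *)
Require Import Defs.
From mathcomp Require Import all_boot all_order all_algebra.
From mathcomp Require Import all_classical all_reals all_analysis.
From mathcomp Require Import measurable_realfun ring lra.
Import Order.TTheory GRing.Theory Num.Theory.
Import numFieldNormedType.Exports.
Local Open Scope ring_scope.
Local Open Scope classical_set_scope.

(** Test the equation against the weight w(x) = (L - x)^lambda, which vanishes
    to order lambda > 4 at x = L. All boundary contributions at L disappear and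
    the ones at 0 add up to B0(v) ([boundary_form_cutpow]), so that
<<
      J' = - int v (w'''' + w'') + (lambda / 2) int v^2 (L - x)^(lambda - 1)
           + B0(v).
>>
    The term that is linear in v is absorbed by half of the quadratic one:
    completing a square leaves exactly C_lambda ([weighted_young]). The other
    half controls J^2, by the Cauchy-Schwarz inequality for the splitting
    (L - x)^(2 lambda) = (L - x)^(lambda - 1) (L - x)^(lambda + 1)
    ([weighted_cauchy_schwarz]). Together ([moment_growth])
<<
      J' >= kappa^2 J^2 + H_lambda >= kappa^2 J^2 + a^2.
>>
    Hence atan (kappa J / a) - a kappa t is nondecreasing in t > 0, and it tends
    to c0 as t -> 0 ([riccati_comparison]). Since atan < pi / 2, the angle
    a kappa t + c0 stays below pi / 2 during the whole life of the solution,
    which bounds the blow-up time; applying tan gives the lower bound for J.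

    The least regular weight that appears is (L - x)^(lambda - 7), with
    an exponent above -1: it may be unbounded near L but is integrable, and this
    is where lambda > 6 is used. *)

(** * Truncated powers *)

(** The extension by zero of |x - L|^m past L is of class C^4 on the whole line
    for m > 4, and its derivatives are again multiples of truncated powers. *)
Definition cutpow {R : realType} (L m x : R) : R :=
  if x < L then (L - x) `^ m else 0.

Lemma cutpowE {R : realType} (L m x : R) : x < L ->
  cutpow L m x = (L - x) `^ m.
Proof. by rewrite /cutpow => ->. Qed.

Lemma cutpow_ge0 {R : realType} (L m x : R) : 0 <= cutpow L m x.
Proof. by rewrite /cutpow; case: ifPn => _ //; exact: powR_ge0. Qed.

Lemma cutpow0 {R : realType} (L m x : R) : L <= x -> cutpow L m x = 0.
Proof. by rewrite /cutpow leNgt => /negbTE ->. Qed.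

Lemma is_derive_cutpow_lt {R : realType} (L m x : R) : x < L ->
  is_derive x 1 (cutpow L m) (- m * cutpow L (m - 1) x).
Proof.
move=> xL; apply: (@near_eq_is_derive _ _ _ (fun y => (L - y) `^ m)).
  near=> y; rewrite cutpowE//; near: y; exact: lt_nbhsl.
have Lx : 0 < L - x by rewrite subr_gt0.
have := is_derive1_powR m Lx; rewrite cutpowE// => dp.
have dL : is_derive x 1 (fun y : R => L - y) (-1).
  have := is_deriveB (is_derive_cst L x 1) (is_derive_id x 1).
  by move/is_derive_eq; apply; rewrite add0r.
have := @is_derive1_comp R (fun z : R => z `^ m) (fun y => L - y) x _ _ dp dL.
by move/is_derive_eq; apply; ring.
Unshelve. all: by end_near. Qed.

Lemma is_derive_cutpow_gt {R : realType} (L m x : R) : L < x ->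
  is_derive x 1 (cutpow L m) 0.
Proof.
move=> Lx; apply: (@near_eq_is_derive _ _ _ (cst 0)).
by near=> y; rewrite cutpow0//; apply/ltW; near: y; exact: lt_nbhsr.
Unshelve. all: by end_near. Qed.

Lemma continuous_cutpow {R : realType} (L m : R) : 0 < m ->
  continuous (cutpow L m).
Proof.
move=> m0 x; have [xL|Lx|->] := ltgtP x L.
- have /@ex_derive := is_derive_cutpow_lt L m x xL.
  by move/derivable1_diffP/differentiable_continuous.
- have /@ex_derive := is_derive_cutpow_gt L m x Lx.
  by move/derivable1_diffP/differentiable_continuous.
rewrite /continuous_at [cutpow L m L]cutpow0//.
apply/cvgr0Pnorm_lt => e e0.
have /cvgr0Pnorm_lt/(_ e e0) := powR_cvg0 m0.
rewrite /at_right => -[d /= d0 dP].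
exists d => //= y; rewrite /= => yd.
have [yL|Ly] := ltP y L; last by rewrite cutpow0// normr0.
rewrite cutpowE//; apply: dP => /=; rewrite ?subr_gt0//.
rewrite sub0r normrN; exact: yd.
Qed.

(** At the corner x = L the difference quotient of cutpow L m at h is
    - cutpow L (m - 1) (L + h) on both sides, so that continuity of the lower
    power gives the derivative. *)
Lemma is_derive_cutpow {R : realType} (L m x : R) : 1 < m ->
  is_derive x 1 (cutpow L m) (- m * cutpow L (m - 1) x).
Proof.
move=> m1; have [xL|Lx|->] := ltgtP x L.
- exact: is_derive_cutpow_lt.
- by rewrite cutpow0 ?mulr0; [exact: is_derive_cutpow_gt|exact: ltW].
rewrite cutpow0// mulr0.
have m10 : 0 < m - 1 by rewrite subr_gt0.
have lim0 : h^-1 *: (cutpow L m (h *: 1 + L) - cutpow L m L) @[h --> 0^'] --> (0 : R).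
  (* the quotient equals - cutpow L (m - 1) (h + L) for h != 0 *)
  apply: (@cvg_trans _ (- cutpow L (m - 1) (h + L) @[h --> (0 : R)^'])).
    apply: near_eq_cvg; near=> h.
    have h0 : h != 0 by near: h; exact: nbhs_dnbhs_neq.
    rewrite (cutpow0 _ _ L)// subr0 /GRing.scale/= mulr1.
    have [hL|Lh] := ltP (h + L) L; last by rewrite !cutpow0// mulr0 oppr0.
    rewrite !cutpowE//.
    have hn : h < 0 by rewrite -(ltrD2r L) add0r.
    have -> : L - (h + L) = - h by ring.
    have nh : 0 <= - h by rewrite oppr_ge0 ltW.
    have m0 : 0 < m by apply: lt_trans m1.
    rewrite -(@mulr_powRB1 _ (- h) m)//.
    by field.
  apply: (@cvg_comp _ _ _ _ (fun y => - y) _ (nbhs (0 : R))); last first.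
    have : - y @[y --> (0 : R)] --> - (0 : R) by apply: cvgN; exact: cvg_id.
    by rewrite oppr0.
  apply: (@cvg_comp _ _ _ (fun h : R => h + L) (cutpow L (m - 1)) _ (nbhs L)).
    apply: cvg_within_filter.
    have : h + L @[h --> (0 : R)] --> 0 + L.
      by apply: cvgD; [exact: cvg_id|exact: cvg_cst].
    by rewrite add0r.
  have := continuous_cutpow L (m - 1) m10 L.
  by rewrite /continuous_at [X in _ --> X]cutpow0.
apply: DeriveDef.
  by apply/cvg_ex; exists 0; exact: lim0.
exact/cvg_lim.
Unshelve. all: by end_near. Qed.

Lemma derive1n_cutpow {R : realType} (L m : R) (k : nat) : k%:R < m ->
  derive1n k (cutpow L m)
  = (fun x => (\prod_(i < k) (i%:R - m)) * cutpow L (m - k%:R) x).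
Proof.
elim: k => [_|k IH km].
  by rewrite derive1n0; apply/funext => x; rewrite big_ord0 mul1r subr0.
have k1 : 1 < m - k%:R by rewrite ltrBrDr addrC natr1.
rewrite derive1nS IH; last by rewrite (lt_trans _ km)// ltr_nat.
apply/funext => x; rewrite derive1E.
have dx := is_derive_cutpow L (m - k%:R) x k1.
rewrite (_ : (fun y => _) = (\prod_(i < k) (i%:R - m)) \*: cutpow L (m - k%:R))//.
rewrite derive_val big_ord_recr/= /GRing.scale/=.
have -> : m - k.+1%:R = m - k%:R - 1 by rewrite -natr1 opprD addrA.
ring.
Qed.

Lemma C4_cutpow {R : realType} (L m : R) : 4 < m -> C4 (cutpow L m).
Proof.
move=> m4; split => [k x k4|].
  have km : k.+1%:R < m by apply: le_lt_trans m4; rewrite ler_nat.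
  rewrite derive1n_cutpow; last by rewrite (lt_trans _ km)// ltr_nat.
  have k1 : 1 < m - k%:R by rewrite ltrBrDr addrC natr1.
  have [dx _] := is_derive_cutpow L (m - k%:R) x k1.
  exact: (@derivableZ _ _ _ (cutpow L (m - k%:R))).
rewrite derive1n_cutpow// => x.
apply: cvgM; first exact: cvg_cst.
by apply: continuous_cutpow; rewrite subr_gt0.
Qed.

(** * Integrals of truncated powers *)

Lemma measurable_cutpow {R : realType} (L m : R) (D : set R) :
  measurable_fun D (cutpow L m).
Proof.
apply: measurable_funTS; rewrite /cutpow; apply: measurable_fun_ifT => //.
- exact: measurable_fun_ltr.
- apply: (@measurableT_comp _ _ _ _ _ _ (@powR R ^~ m)).
    exact: measurable_powR.
  exact: measurable_funB.
Qed.

Lemma integral_cutpow_itvcc {R : realType} (L m c : R) : -1 < m -> 0 < c ->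
  c < L ->
  (\int[lebesgue_measure]_(x in `[0%R, c]) (cutpow L m x)%:E
   = ((m + 1)^-1 * (L `^ (m + 1) - cutpow L (m + 1) c))%:E)%E.
Proof.
move=> m1 c0 cL; have L0 : 0 < L := lt_trans c0 cL.
have m10 : m + 1 != 0 by rewrite gt_eqF// -ltrBlDr sub0r.
pose F := (- (m + 1)^-1) \*: cutpow L (m + 1).
have FE (x : R) : F x = - (m + 1)^-1 * cutpow L (m + 1) x by [].
have dF (x : R) : x < L -> is_derive x 1 F (cutpow L m x).
  move=> xL; have := is_derive_cutpow_lt L (m + 1) x xL.
  move/(is_deriveZ (- (m + 1)^-1))/is_derive_eq; apply.
  rewrite addrK /GRing.scale/=; by field.
have cF (x : R) : x < L -> {for x, continuous F}.
  by move=> /dF/@ex_derive/derivable1_diffP/differentiable_continuous.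
rewrite (@continuous_FTC2 _ _ F)//.
- rewrite -EFinB !FE; congr EFin.
  rewrite [cutpow _ _ 0]cutpowE// subr0; ring.
- apply: derivable_within_continuous => x.
  rewrite in_itv/= => /andP[_ xc].
  exact/ex_derive/is_derive_cutpow_lt/(le_lt_trans xc).
- split.
  + move=> x; rewrite in_itv/= => /andP[_ xc].
    by have dx := dF x (lt_trans xc cL); exact: ex_derive.
  + exact/cvg_at_right_filter/cF.
  + exact/cvg_at_left_filter/cF.
- move=> x; rewrite in_itv/= => /andP[_ xc].
  have dx := dF x (lt_trans xc cL).
  by rewrite derive1E derive_val.
Qed.

(** For m < 0 the integrand is unbounded near L, so the primitive is used on
    [0, c] with c < L, and c tends to L by monotone convergence. *)
Lemma integral_cutpow {R : realType} (L m : R) : 0 < L -> -1 < m ->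
  (\int[lebesgue_measure]_(x in `]0%R, L[) (cutpow L m x)%:E
   = ((m + 1)^-1 * L `^ (m + 1))%:E)%E.
Proof.
move=> L0 m1; have m10 : 0 < m + 1 by rewrite -ltrBlDr sub0r.
(* the shift by two keeps c n strictly inside ]0, L[ for every n *)
pose c (n : nat) : R := L - L / n.+2%:R.
have cL n : c n < L by rewrite /c ltrBlDr ltrDl divr_gt0.
have c0 n : 0 < c n.
  by rewrite /c subr_gt0 ltr_pdivrMr// ltr_pMr// ltr1n.
have ccvg : c n @[n --> \oo] --> L.
  rewrite /c -[X in _ --> X]subr0; apply: cvgB; first exact: cvg_cst.
  rewrite -(mulr0 L); apply: cvgM; first exact: cvg_cst.
  apply/gtr0_cvgV0; first exact: nearW.
  have := @cvgr_idn R; rewrite -(cvg_shiftn 2)/=.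
  by under eq_fun do rewrite addn2.
rewrite integral_itv_obnd_cbnd; last first.
  apply/measurable_EFinP; exact: measurable_cutpow.
have -> : `[0, L[%classic = \bigcup_n `[0, c n]%classic.
  apply/seteqP; split => x /=.
    rewrite in_itv/= => /andP[x0 xL].
    have /cvgrPdist_lt/(_ (L - x)) := ccvg.
    rewrite subr_gt0 => /(_ xL)[N _ /(_ N (leqnn N))/= HN].
    exists N => //=; rewrite in_itv/= x0/=.
    move: HN; rewrite gtr0_norm ?subr_gt0// => HN.
    by rewrite ltW// -(ltrN2 (c N)) -(ltrD2l L).
  by case=> n _ /=; rewrite !in_itv/= => /andP[-> /le_lt_trans]; exact.
have cnd : nondecreasing_seq (fun n => `[0, c n]%classic).
  move=> n p np; rewrite subsetEset => x /=; rewrite !in_itv/=.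
  move=> /andP[-> /=/le_trans]; apply.
  by rewrite /c lerD2l lerN2 ler_pM2l// lef_pV2 ?posrE// ler_nat !ltnS.
have cvI : (\int[lebesgue_measure]_(x in `[0%R, c n]) (cutpow L m x)%:E
    @[n --> \oo] --> \int[lebesgue_measure]_(x in \bigcup_n `[0%R, c n])
      (cutpow L m x)%:E)%E.
  apply: ge0_nondecreasing_set_cvg_integral => //.
  - by move=> n; apply/measurable_EFinP; exact: measurable_cutpow.
  - by move=> n x _; rewrite lee_fin cutpow_ge0.
rewrite -(cvg_lim _ cvI)//; apply/cvg_lim => //.
under eq_fun do rewrite integral_cutpow_itvcc//.
apply: cvg_EFin; first exact: nearW.
apply: cvgM; first exact: cvg_cst.
rewrite -[X in _ --> X]subr0; apply: cvgB; first exact: cvg_cst.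
apply: (@cvg_comp _ _ _ c (cutpow L (m + 1)) _ (nbhs L)) => //.
have := continuous_cutpow L (m + 1) m10 L.
by rewrite /continuous_at [X in _ --> X]cutpow0.
Qed.

Lemma integrable_cutpow {R : realType} (L m : R) : 0 < L -> -1 < m ->
  lebesgue_measure.-integrable `]0, L[ (EFin \o cutpow L m).
Proof.
move=> L0 m1; apply/integrableP; split.
  apply/measurable_EFinP; exact: measurable_cutpow.
under eq_integral do rewrite /= ger0_norm ?cutpow_ge0//.
by rewrite integral_cutpow// ltry.
Qed.

Lemma Rintegral_cutpow {R : realType} (L m : R) : 0 < L -> -1 < m ->
  \int[lebesgue_measure]_(x in `]0, L[) cutpow L m x = (m + 1)^-1 * L `^ (m + 1).
Proof. by move=> L0 m1; rewrite /Rintegral integral_cutpow. Qed.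

(** * Weighted integral inequalities *)

Lemma cutpowS {R : realType} (L m x : R) : x < L ->
  cutpow L (m + 1) x = (L - x) * cutpow L m x.
Proof.
move=> xL; have Lx : 0 < L - x by rewrite subr_gt0.
rewrite !cutpowE// powRD; last by rewrite (gt_eqF Lx) implybT.
by rewrite powRr1 1?mulrC// ltW.
Qed.

Lemma cutpow_le {R : realType} (L m x : R) : 0 <= m -> 0 <= x < L ->
  cutpow L m x <= L `^ m.
Proof.
move=> m0 /andP[x0 xL]; rewrite cutpowE//.
by apply: ge0_ler_powR; rewrite ?nnegrE ?subr_ge0 ?lerBlDr ?lerDl// ltW// (le_lt_trans x0).
Qed.

Lemma integrable_addr (d : measure_display) (T : measurableType d)
    (R : realType) (mu : {measure set T -> \bar R}) (D : set T)
    (f g : T -> R) : measurable D ->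
  mu.-integrable D (EFin \o f) -> mu.-integrable D (EFin \o g) ->
  mu.-integrable D (EFin \o (fun x => f x + g x)).
Proof. by move=> mD fi gi; exact: (integrableD mD fi gi). Qed.

Lemma integrable_scaler (d : measure_display) (T : measurableType d)
    (R : realType) (mu : {measure set T -> \bar R}) (D : set T)
    (c : R) (f : T -> R) : measurable D ->
  mu.-integrable D (EFin \o f) ->
  mu.-integrable D (EFin \o (fun x => c * f x)).
Proof. by move=> mD fi; exact: (integrableZl mD c fi). Qed.

(** Comparison with u^2 + 1, since |u| <= u^2 + 1 and the interval is bounded. *)
Lemma integrable_of_sqr {R : realType} (a b : R) (u : R -> R) :
  measurable_fun `]a, b[ u ->
  lebesgue_measure.-integrable `]a, b[ (fun x => (u x ^+ 2)%:E) ->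
  lebesgue_measure.-integrable `]a, b[ (EFin \o u).
Proof.
move=> mu iu.
have i1 : lebesgue_measure.-integrable `]a, b[ (EFin \o (fun _ : R => 1 : R)).
  apply/integrableP; split; first exact/measurable_EFinP.
  rewrite /= normr1 integral_cst// mul1e.
  change (lebesgue_measure (`]a, b[%classic : set R) < +oo)%E.
  rewrite lebesgue_measure_itv/=.
  by case: ifP => _; rewrite ?ltry// -EFinB ltry.
have : lebesgue_measure.-integrable `]a, b[ (EFin \o (fun x => u x ^+ 2 + 1)).
  exact: integrable_addr.
apply: le_integrable => //.
  exact/measurable_EFinP.
move=> x _; rewrite /= lee_fin [leRHS]ger0_norm ?addr_ge0 ?sqr_ge0//.
by rewrite ler_norml; nra.
Qed.

Lemma integrable_mul_cutpow {R : realType} (L m : R) (f : R -> R) : 0 <= m ->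
  lebesgue_measure.-integrable `]0, L[ (EFin \o f) ->
  lebesgue_measure.-integrable `]0, L[ (EFin \o (fun x => f x * cutpow L m x)).
Proof.
move=> m0 fi; have mf := measurable_int _ fi.
have : lebesgue_measure.-integrable `]0, L[ (EFin \o (fun x => L `^ m * f x)).
  exact: integrable_scaler.
apply: le_integrable => //.
  apply/measurable_EFinP; apply: measurable_funM; first exact/measurable_EFinP.
  exact: measurable_cutpow.
move=> x; rewrite /= in_itv/= => /andP[x0 xL].
rewrite lee_fin !normrM mulrC !(ger0_norm (powR_ge0 _ _)).
rewrite (ger0_norm (cutpow_ge0 _ _ _)) ler_wpM2r//.
by apply: cutpow_le; rewrite // ltW.
Qed.

Lemma powRDn {R : realType} (L e : R) (n : nat) : 0 < L ->
  L `^ (e + n%:R) = L `^ e * L ^+ n.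
Proof.
move=> L0; rewrite powRD; last by rewrite (gt_eqF L0) implybT.
by rewrite powR_mulrn// ltW.
Qed.

(** The integral of (L - x)^m (u - s (L - x))^2 is nonnegative for every real s;
    the inequality is the optimal choice of s. *)
Lemma weighted_cauchy_schwarz {R : realType} (L m : R) (u : R -> R) :
  0 < L -> 0 <= m -> measurable_fun `]0, L[ u ->
  lebesgue_measure.-integrable `]0, L[ (fun x => (u x ^+ 2)%:E) ->
  (\int[lebesgue_measure]_(x in `]0, L[) (u x * cutpow L (m + 1) x)) ^+ 2
  <= L `^ (m + 3) / (m + 3)
     * \int[lebesgue_measure]_(x in `]0, L[) (u x ^+ 2 * cutpow L m x).
Proof.
move=> L0 m0 mu iu2; have iu := integrable_of_sqr _ _ _ mu iu2.
set J := \int[lebesgue_measure]_(x in `]0, L[) (u x * cutpow L (m + 1) x).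
set I := \int[lebesgue_measure]_(x in `]0, L[) (u x ^+ 2 * cutpow L m x).
have iJ : lebesgue_measure.-integrable `]0, L[
    (EFin \o (fun x => u x * cutpow L (m + 1) x)).
  by apply: integrable_mul_cutpow => //; rewrite addr_ge0.
have iI : lebesgue_measure.-integrable `]0, L[
    (EFin \o (fun x => u x ^+ 2 * cutpow L m x)).
  exact: (integrable_mul_cutpow _ _ (fun x => u x ^+ 2)).
have iK : lebesgue_measure.-integrable `]0, L[ (EFin \o cutpow L (m + 2)).
  by apply: integrable_cutpow => //; lra.
set K := L `^ (m + 3) / (m + 3).
have KE : \int[lebesgue_measure]_(x in `]0, L[) cutpow L (m + 2) x = K.
  rewrite Rintegral_cutpow//; last by lra.
  by rewrite -addrA (_ : 2 + 1 = 3 :> R) 1?mulrC//; ring.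
have K0 : 0 < K by rewrite divr_gt0 ?powR_gt0//; lra.
have H s : (2 * s) * J <= I + s ^+ 2 * K.
  rewrite -KE /J -!RintegralZl// /I -RintegralD//.
  - apply: le_Rintegral => //.
    + exact: integrable_scaler.
    + by apply: integrable_addr => //; exact: integrable_scaler.
    + move=> x; rewrite /= in_itv/= => /andP[_ xL].
      rewrite (_ : m + 2 = m + 1 + 1); last by ring.
      rewrite !cutpowS//; have := cutpow_ge0 L m x.
      set p := cutpow _ _ _ => p0; rewrite -subr_ge0.
      rewrite (_ : _ - _ = p * (u x - s * (L - x)) ^+ 2); last by ring.
      by rewrite mulr_ge0// sqr_ge0.
  - exact: integrable_scaler.
(* J / K minimises the quadratic polynomial I - 2 s J + s^2 K *)
have := H (J / K).
rewrite -(ler_pM2l K0) (_ : K * (2 * _ * J) = 2 * J ^+ 2); last first.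
  by field; rewrite gt_eqF.
rewrite (_ : K * (I + _) = K * I + J ^+ 2); last by field; rewrite gt_eqF.
by move=> HH; lra.
Qed.

(** With y = L - x and A = (lambda - 2) (lambda - 3), the difference of the two
    integrands is lambda y^(lambda - 7) (u y^3 / 2 - (lambda - 1) (A + y^2))^2;
    the part of this square free of u integrates to C_lambda. *)
Lemma weighted_young {R : realType} (L lambda : R) (u : R -> R) :
  0 < L -> 6 < lambda -> measurable_fun `]0, L[ u ->
  lebesgue_measure.-integrable `]0, L[ (fun x => (u x ^+ 2)%:E) ->
  \int[lebesgue_measure]_(x in `]0, L[)
     (u x * (lambda * (lambda - 1) * (lambda - 2) * (lambda - 3)
               * cutpow L (lambda - 4) x
             + lambda * (lambda - 1) * cutpow L (lambda - 2) x))
  <= lambda / 4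
     * \int[lebesgue_measure]_(x in `]0, L[) (u x ^+ 2 * cutpow L (lambda - 1) x)
     + C_lambda L lambda.
Proof.
move=> L0 l6 mu iu2; have iu := integrable_of_sqr _ _ _ mu iu2.
have iI : lebesgue_measure.-integrable `]0, L[
    (EFin \o (fun x => u x ^+ 2 * cutpow L (lambda - 1) x)).
  by apply: (integrable_mul_cutpow _ _ (fun x => u x ^+ 2)) => //; lra.
have iu4 : lebesgue_measure.-integrable `]0, L[
    (EFin \o (fun x => u x * cutpow L (lambda - 4) x)).
  by apply: integrable_mul_cutpow => //; lra.
have iu2' : lebesgue_measure.-integrable `]0, L[
    (EFin \o (fun x => u x * cutpow L (lambda - 2) x)).
  by apply: integrable_mul_cutpow => //; lra.
have i7 : lebesgue_measure.-integrable `]0, L[ (EFin \o cutpow L (lambda - 7)).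
  by apply: integrable_cutpow => //; lra.
have i5 : lebesgue_measure.-integrable `]0, L[ (EFin \o cutpow L (lambda - 5)).
  by apply: integrable_cutpow => //; lra.
have i3 : lebesgue_measure.-integrable `]0, L[ (EFin \o cutpow L (lambda - 3)).
  by apply: integrable_cutpow => //; lra.
pose A := (lambda - 2) * (lambda - 3).
pose M := lambda * (lambda - 1) ^+ 2.
pose w x := A ^+ 2 * cutpow L (lambda - 7) x
  + ((2 * A) * cutpow L (lambda - 5) x + cutpow L (lambda - 3) x).
have iw5 : lebesgue_measure.-integrable `]0, L[ (EFin \o
    (fun x => (2 * A) * cutpow L (lambda - 5) x + cutpow L (lambda - 3) x)).
  by apply: integrable_addr => //; exact: integrable_scaler.
have iw : lebesgue_measure.-integrable `]0, L[ (EFin \o w).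
  by apply: integrable_addr => //; exact: integrable_scaler.
have -> : C_lambda L lambda = M * \int[lebesgue_measure]_(x in `]0, L[) w x.
  rewrite RintegralD//; last exact: integrable_scaler.
  rewrite RintegralD//; last exact: integrable_scaler.
  rewrite !RintegralZl// !Rintegral_cutpow//; [|lra|lra|lra].
  rewrite (_ : lambda - 7 + 1 = lambda - 6); last by ring.
  rewrite (_ : lambda - 5 + 1 = (lambda - 6) + 2%:R); last by ring.
  rewrite (_ : lambda - 3 + 1 = (lambda - 6) + 4%:R); last by ring.
  rewrite !powRDn//.
  rewrite /C_lambda /M /A; field.
  by apply/and3P; split; apply/eqP; lra.
rewrite -RintegralZl// -RintegralZl// -RintegralD//; [|exact: integrable_scaler..].
apply: le_Rintegral => //.
- pose c1 := lambda * (lambda - 1) * (lambda - 2) * (lambda - 3).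
  pose c2 := lambda * (lambda - 1).
  rewrite (_ : EFin \o _ = EFin \o (fun x => c1 * (u x * cutpow L (lambda - 4) x)
     + c2 * (u x * cutpow L (lambda - 2) x))).
    by apply: integrable_addr => //; exact: integrable_scaler.
  by apply/funext => x /=; congr EFin; rewrite /c1 /c2; ring.
- by apply: integrable_addr => //; exact: integrable_scaler.
- move=> x; rewrite /= in_itv/= => /andP[_ xL].
  rewrite /w.
  (* all weights as multiples of the most singular one, (L - x)^(lambda - 7) *)
  rewrite (_ : lambda - 5 = lambda - 7 + 1 + 1); last by ring.
  rewrite (_ : lambda - 4 = lambda - 7 + 1 + 1 + 1); last by ring.
  rewrite (_ : lambda - 3 = lambda - 7 + 1 + 1 + 1 + 1); last by ring.
  rewrite (_ : lambda - 2 = lambda - 7 + 1 + 1 + 1 + 1 + 1); last by ring.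
  rewrite (_ : lambda - 1 = lambda - 7 + 1 + 1 + 1 + 1 + 1 + 1); last by ring.
  rewrite !cutpowS//; have := cutpow_ge0 L (lambda - 7) x.
  set p := cutpow _ _ _ => p0; rewrite -subr_ge0.
  rewrite (_ : _ - _ = lambda * p * (u x * (L - x) ^+ 3 / 2
    - (lambda - 1) * (A + (L - x) ^+ 2)) ^+ 2); last by rewrite /A /M; field.
  by rewrite mulr_ge0 ?sqr_ge0// mulr_ge0//; lra.
Qed.

(** * The moment inequality *)

Lemma derive1n_cutpow_endpoint {R : realType} (L m : R) (k : nat) :
  k%:R < m -> derive1n k (cutpow L m) L = 0.
Proof. by move=> km; rewrite derive1n_cutpow// cutpow0// mulr0. Qed.

Lemma derive1n_cutpow_origin {R : realType} (L m : R) (k : nat) : 0 < L ->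
  k%:R < m ->
  derive1n k (cutpow L m) 0 = (\prod_(i < k) (i%:R - m)) * L `^ (m - k%:R).
Proof. by move=> L0 km; rewrite derive1n_cutpow// cutpowE// subr0. Qed.

(** B0 is the boundary form of the weight: its first three derivatives and the
    weight itself vanish at L, and only their values at 0 remain. *)
Lemma boundary_form_cutpow {R : realType} (L lambda : R) (v : R -> R -> R)
    (t : R) : 0 < L -> 6 < lambda ->
  boundary_form L (v^~ t) (cutpow L lambda) = B0 L lambda v t.
Proof.
move=> L0 l6; rewrite /boundary_form /boundary_flux.
rewrite !derive1n_cutpow_endpoint ?(cutpow0 L lambda L)//; [|lra|lra|lra].
rewrite !derive1n_cutpow_origin//; [|lra|lra|lra].
rewrite (cutpowE L lambda 0)// subr0 !big_ord_recr !big_ord0/= /B0.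
have E0 : L `^ lambda = L `^ (lambda - 3) * L ^+ 3.
  by rewrite -powRDn// subrK.
have E1 : L `^ (lambda - 1) = L `^ (lambda - 3) * L ^+ 2.
  by rewrite -powRDn//; congr powR; ring.
have E2 : L `^ (lambda - 2) = L `^ (lambda - 3) * L ^+ 1.
  by rewrite -powRDn//; congr powR; ring.
rewrite !mulr1n E0 E1 E2.
(* the identity is rational in L, P and the traces, taken as variables *)
move: (L `^ (lambda - 3)) => P.
rewrite !mulr0.
move: (trace 0^'+ 0%N _) (trace 0^'+ 1%N _) => T0 T1.
move: (trace 0^'+ 2%N _) (trace 0^'+ 3%N _) => T2 T3.
by field; rewrite gt_eqF.
Qed.

Lemma kappa_gt0 {R : realType} (L lambda : R) : 0 < L -> 6 < lambda ->
  0 < kappa L lambda.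
Proof.
move=> L0 l6; rewrite /kappa sqrtr_gt0 mulr_gt0 ?powR_gt0// divr_gt0//.
by rewrite mulr_gt0//; lra.
Qed.

Lemma J_cutpowE {R : realType} (L lambda : R) (u : R -> R) :
  J L lambda u = \int[lebesgue_measure]_(x in `]0, L[) (u x * cutpow L lambda x).
Proof.
apply: eq_Rintegral => x; rewrite inE/= in_itv/= => /andP[_ xL].
by rewrite cutpowE// distrC gtr0_norm// subr_gt0.
Qed.

(** The right-hand side is the value that the weak equation prescribes for J'.
    The integral I of v^2 (L - x)^(lambda - 1) comes with the factor lambda / 2;
    Young's inequality costs lambda / 4 of it, and kappa^2 is the constant for
    which the remaining lambda / 4 dominates J^2. *)
Lemma moment_growth {R : realType} (L lambda : R) (v : R -> R -> R) (t : R) :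
  0 < L -> 6 < lambda -> admissible L (v^~ t) ->
  kappa L lambda ^+ 2 * J L lambda (v^~ t) ^+ 2 + H_lambda L lambda v t
  <= - (\int[lebesgue_measure]_(x in `]0, L[)
          (v x t * (derive1n 4 (cutpow L lambda) x + derive1n 2 (cutpow L lambda) x)))
     - 2^-1 * (\int[lebesgue_measure]_(x in `]0, L[)
          (v x t ^+ 2 * derive1n 1 (cutpow L lambda) x))
     + boundary_form L (v^~ t) (cutpow L lambda).
Proof.
move=> L0 l6 [mv iv2 _ _]; rewrite boundary_form_cutpow// J_cutpowE.
have i1 : lebesgue_measure.-integrable `]0, L[
    (EFin \o (fun x => v x t ^+ 2 * cutpow L (lambda - 1) x)).
  apply: (integrable_mul_cutpow _ _ (fun x => v x t ^+ 2)) => //; lra.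
set j := \int[lebesgue_measure]_(x in `]0, L[) (v x t * cutpow L lambda x).
pose I := \int[lebesgue_measure]_(x in `]0, L[)
  (v x t ^+ 2 * cutpow L (lambda - 1) x).
pose G := \int[lebesgue_measure]_(x in `]0, L[)
  (v x t * (lambda * (lambda - 1) * (lambda - 2) * (lambda - 3)
              * cutpow L (lambda - 4) x
            + lambda * (lambda - 1) * cutpow L (lambda - 2) x)).
have -> : \int[lebesgue_measure]_(x in `]0, L[)
    (v x t * (derive1n 4 (cutpow L lambda) x + derive1n 2 (cutpow L lambda) x))
  = G.
  apply: eq_Rintegral => x _; congr (_ * _).
  rewrite !derive1n_cutpow; [|lra|lra].
  by rewrite !big_ord_recr !big_ord0/=; congr (_ * _ + _ * _); ring.
have -> : \int[lebesgue_measure]_(x in `]0, L[)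
    (v x t ^+ 2 * derive1n 1 (cutpow L lambda) x) = - lambda * I.
  rewrite -RintegralZl//; apply: eq_Rintegral => x _.
  rewrite derive1n_cutpow; last lra.
  by rewrite !big_ord_recr !big_ord0/=; ring.
have Y : G <= lambda / 4 * I + C_lambda L lambda.
  exact: (weighted_young L lambda (v^~ t)).
have CS : j ^+ 2 <= L `^ (lambda + 2) / (lambda + 2) * I.
  have := weighted_cauchy_schwarz L (lambda - 1) (v^~ t) L0 _ mv iv2.
  rewrite subrK (_ : lambda - 1 + 3 = lambda + 2); last by ring.
  by apply; lra.
have k2 : kappa L lambda ^+ 2 * (L `^ (lambda + 2) / (lambda + 2)) = lambda / 4.
  rewrite /kappa sqr_sqrtr; last first.
    by rewrite mulr_ge0 ?powR_ge0// divr_ge0// mulr_ge0//; lra.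
  rewrite powRN (addrC 2 lambda); field.
  by apply/andP; split; [apply/eqP; lra|rewrite gt_eqF// powR_gt0].
have : kappa L lambda ^+ 2 * j ^+ 2 <= lambda / 4 * I.
  by rewrite -k2 -mulrA ler_wpM2l ?sqr_ge0.
move: Y; rewrite /H_lambda; clearbody I j G => Y kj.
by lra.
Qed.

(** * A Riccati differential inequality *)

(** Dividing y' >= k^2 y^2 + a^2 by 1 + (k y / a)^2 bounds the derivative of
    atan (k y / a) below by a k; the initial value only enters as a right limit,
    so the monotone function atan (k y / a) - a k s is compared with its limit. *)
Lemma riccati_comparison {R : realType} (y : R -> R) (a k y0 t : R) :
  0 < a -> 0 < k -> 0 < t ->
  (forall s, 0 < s <= t -> derivable y s 1) ->
  (forall s, 0 < s <= t -> k ^+ 2 * y s ^+ 2 + a ^+ 2 <= derive1 y s) ->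
  y s @[s --> 0^'+] --> y0 ->
  a * k * t + atan (k * y0 / a) <= atan (k * y t / a).
Proof.
move=> a0 k0 t0 yd ydy ycv.
pose g s := atan (k / a * y s) - a * k * s.
have dg s : 0 < s <= t ->
    is_derive s 1 g ((1 + (k / a * y s) ^+ 2)^-1 * (k / a * derive1 y s) - a * k).
  move=> st; have dys : is_derive s 1 y (derive1 y s).
    by rewrite derive1E; exact/derivableP/yd.
  have d1 : is_derive s 1 (fun x => k / a * y x) (k / a * derive1 y s).
    exact: (is_deriveZ (k / a) dys).
  have d2 := @is_derive1_comp R atan (fun x => k / a * y x) s _ _
    (is_derive1_atan _) d1.
  have d3 : is_derive s 1 (fun x : R => a * k * x) (a * k).
    by have := is_deriveZ (a * k) (is_derive_id s 1); move/is_derive_eq; apply; rewrite /GRing.scale/= mulr1.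
  exact: is_deriveB d2 d3.
have g_ge0 s : 0 < s <= t -> 0 <= g^`() s.
  move=> st; have dgs := dg s st; rewrite derive1E derive_val.
  have pos : 0 < 1 + (k / a * y s) ^+ 2 by rewrite ltr_pwDl// sqr_ge0.
  rewrite subr_ge0 ler_pdivlMl//.
  have -> : (1 + (k / a * y s) ^+ 2) * (a * k) = k / a * (k ^+ 2 * y s ^+ 2 + a ^+ 2).
    by field; rewrite gt_eqF.
  by rewrite ler_pM2l ?divr_gt0// ydy.
have gmono : {in `]0, t]%R &, {homo g : x y / x <= y}}.
  apply: (@ger0_derive1_le_oc _ g 0 t) => [x|x|].
  - rewrite in_itv/= => /andP[x0 xt].
    have xt' : 0 < x <= t by rewrite x0 ltW.
    by have dgx := dg x xt'; exact: ex_derive.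
  - rewrite in_itv/= => /andP[x0 xt].
    by apply: g_ge0; rewrite x0 ltW.
  - apply: derivable_within_continuous => x; rewrite in_itv/= => xt.
    by have dgx := dg x xt; exact: ex_derive.
have gcv : g s @[s --> 0^'+] --> atan (k / a * y0) - a * k * 0.
  apply: cvgB.
    apply: continuous_cvg; first exact: continuous_atan.
    by apply: cvgM => //; exact: cvg_cst.
  apply: cvgM; first exact: cvg_cst.
  by apply: cvg_at_right_filter; exact: cvg_id.
have : atan (k / a * y0) - a * k * 0 <= g t.
  apply: (ler_cvg_to gcv (cvg_cst (g t))).
  near=> s; apply: gmono; rewrite ?in_itv/= ?t0 ?lexx//.
    apply/andP; split; first by near: s; exact: nbhs_right_gt.
    by apply/ltW; near: s; exact: nbhs_right_lt.
  by apply/ltW; near: s; exact: nbhs_right_lt.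
rewrite mulr0 subr0 /g lerBrDl.
by rewrite !(mulrAC k _ a^-1).
Unshelve. all: by end_near. Qed.

(** * Blow-up *)

(** A lower bound for an arctangent carries both conclusions: applying tan gives
    the lower bound for J, and atan < pi / 2 bounds the time t. *)
Lemma moment_lower_bound {R : realType} (L lambda a : R) (v0 h : R -> R)
    (v : R -> R -> R) (T : \bar R) (t : R) :
  0 < L -> 6 < lambda -> 0 < a -> weak_solution L lambda v0 h v T ->
  0 < t -> (t%:E < T)%E ->
  (forall s, 0 < s <= t -> a ^+ 2 <= H_lambda L lambda v s) ->
  a * kappa L lambda * t + c0 L lambda a v0
  <= atan (kappa L lambda * J L lambda (v^~ t) / a).
Proof.
move=> L0 l6 a0 [_ adm weq init _] t0 tT HH.
have C4psi : C4 (cutpow L lambda) by apply: C4_cutpow; lra.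
have sT s : s <= t -> (s%:E < T)%E by move=> st; apply: le_lt_trans tT; rewrite lee_fin.
have dJ s : 0 < s <= t -> is_derive s 1 (fun s => J L lambda (v^~ s))
    (- (\int[lebesgue_measure]_(x in `]0, L[) (v x s
          * (derive1n 4 (cutpow L lambda) x + derive1n 2 (cutpow L lambda) x)))
     - 2^-1 * (\int[lebesgue_measure]_(x in `]0, L[)
          (v x s ^+ 2 * derive1n 1 (cutpow L lambda) x))
     + boundary_form L (v^~ s) (cutpow L lambda)).
  move=> /andP[s0 st]; have := weq s s0 (sT s st) _ C4psi.
  rewrite /weak_equation.
  by under [X in is_derive _ _ X _ -> _]eq_fun do rewrite -J_cutpowE.
apply: (@riccati_comparison R (fun s => J L lambda (v^~ s)) _ _ _ _ a0 _ t0).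
- exact: kappa_gt0.
- by move=> s /dJ dJs; exact: ex_derive.
- move=> s /[dup] s_in /dJ dJs; have /andP[s0 st] := s_in.
  rewrite derive1E derive_val.
  apply: le_trans (moment_growth L lambda v s L0 l6 (adm s s0 (sT s st))).
  by rewrite lerD2l HH.
- have := init _ C4psi; rewrite -J_cutpowE.
  by under eq_fun do rewrite -J_cutpowE.
Qed.

Theorem theorem3p1 (R : realType) (L lambda a : R) (v0 h : R -> R)
    (L_gt0 : 0 < L) (lambda_gt6 : 6 < lambda) (a_gt0 : 0 < a) :
  (~ exists v : R -> R -> R,
       weak_solution L lambda v0 h v +oo%E /\
       forall t : R, 0 < t -> a ^+ 2 <= H_lambda L lambda v t) /\
  (forall v : R -> R -> R,
     (exists2 T : \bar R, (0 < T)%E & weak_solution L lambda v0 h v T) ->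
     (forall t : R, 0 < t -> (t%:E < blowup_time L lambda v0 h v)%E ->
        a ^+ 2 <= H_lambda L lambda v t) ->
     [/\ ~ weak_solution L lambda v0 h v +oo%E,
         forall t : R, 0 < t -> (t%:E < blowup_time L lambda v0 h v)%E ->
           a / kappa L lambda
             * tan (a * kappa L lambda * t + c0 L lambda a v0)
           <= J L lambda (v^~ t)
       & (blowup_time L lambda v0 h v
          <= ((pi / 2 - c0 L lambda a v0) / (a * kappa L lambda))%:E)%E]).
Proof.
have k_gt0 := kappa_gt0 L lambda L_gt0 lambda_gt6.
have ak_gt0 : 0 < a * kappa L lambda by rewrite mulr_gt0.
set tmax := (pi / 2 - c0 L lambda a v0) / (a * kappa L lambda).
have tmax_gt0 : 0 < tmax by rewrite divr_gt0// subr_gt0 atan_ltpi2.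
(* any t below the supremum lies below some time T up to which v is a solution *)
have main v : (forall t : R, 0 < t ->
      (t%:E < blowup_time L lambda v0 h v)%E ->
      a ^+ 2 <= H_lambda L lambda v t) ->
    forall t : R, 0 < t -> (t%:E < blowup_time L lambda v0 h v)%E ->
    a * kappa L lambda * t + c0 L lambda a v0
    <= atan (kappa L lambda * J L lambda (v^~ t) / a).
  move=> HH t t0 tb.
  have [T [T0 vT] tT] := ereal_sup_gt tb.
  apply: moment_lower_bound vT t0 tT _ => // s /andP[s0 st].
  by apply: HH => //; apply: le_lt_trans tb; rewrite lee_fin.
(* at t = tmax the angle would reach pi / 2 *)
have bound v : (forall t : R, 0 < t ->
      (t%:E < blowup_time L lambda v0 h v)%E ->
      a ^+ 2 <= H_lambda L lambda v t) ->
    (blowup_time L lambda v0 h v <= tmax%:E)%E.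
  move=> HH; rewrite leNgt; apply/negP => /(main v HH _ tmax_gt0).
  apply/negP; rewrite -ltNge (mulrC _ tmax) /tmax divfK ?gt_eqF// subrK.
  exact: atan_ltpi2.
have noglobal v : (forall t : R, 0 < t ->
      (t%:E < blowup_time L lambda v0 h v)%E ->
      a ^+ 2 <= H_lambda L lambda v t) ->
    ~ weak_solution L lambda v0 h v +oo%E.
  move=> HH vy; have := bound v HH; apply/negP; rewrite -ltNge.
  apply: lt_le_trans (ltry tmax) _.
  by apply: ereal_sup_ubound; split; rewrite ?lt0y.
split=> [[v [vy HH]]|v _ HH].
  by apply: (noglobal v _ vy) => t t0 _; exact: HH.
split; [exact: noglobal| |exact: bound].
move=> t t0 tb; have := main v HH t t0 tb.
set th := _ + _; set j := J _ _ _ => thj.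
have th_itv : th \in `](- (pi / 2)), (pi / 2)[%R.
  rewrite in_itv/= (le_lt_trans thj (atan_ltpi2 _)) andbT.
  apply: (lt_le_trans (atan_gtNpi2 (kappa L lambda * J L lambda v0 / a))).
  by rewrite lerDr mulr_ge0// ltW.
have : tan th <= kappa L lambda * j / a.
  rewrite leNgt; apply/negP => /lt_atan; rewrite tanK//.
  by rewrite ltNge thj.
rewrite ler_pdivlMr// => tj.
by rewrite mulrAC ler_pdivrMr// mulrC [j * _]mulrC.
Qed.
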